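(* Let $G$ be a finite group of order $n$ with nontrivial center $Z(G)$ of order $m$ such that $G/Z(G)\cong\mathbb{Z}_p\times\mathbb{Z}_p$, where $p$ is a prime. Then $$\kappa(G)=p^{\,n+m-p-3}\,m^{\,n-2}.$$
   Context: For a finite group $G$, the commuting graph $\mathcal{C}(G)$ is the simple graph with vertex set $G$ in which two distinct elements are adjacent if and only if they commute. $\kappa(G)$ denotes the number of spanning trees of $\mathcal{C}(G)$. *)

(* Defs.v *)
From mathcomp Require Import all_boot all_order all_fingroup all_algebra all_solvable.

Set Implicit Arguments.
Unset Strict Implicit.
Unset Printing Implicit Defensive.

Record sgraph (V : finType) := SGraph {
  adj :> rel V;
  adj_sym : symmetric adj;
  adj_irr : irreflexive adj }.

Definition edges (V : finType) (e : sgraph V) : {set {set V}} :=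
  [set [set x; y] | x in V, y in V & e x y].

Definition edge_rel (V : finType) (F : {set {set V}}) : rel V :=
  fun x y => [set x; y] \in F.

Definition connectedb (V : finType) (r : rel V) : bool :=
  [forall x, forall y, connect r x y].

(* A cycle of a graph is a cyclic sequence of at least 3 pairwise distinct
   vertices, hence of at most #|V|; the bound only serves to make the
   quantification over cycles boolean (see acyclicP). *)
Definition acyclicb (V : finType) (r : rel V) : bool :=
  [forall k : 'I_#|V|.+1, forall c : k.-tuple V,
     ~~ [&& 2 < k, uniq c & path.cycle r c]].

Lemma acyclicP (V : finType) (r : rel V) :
  reflect (forall c : seq V, 2 < size c -> ucycle r c -> False) (acyclicb r).
Proof.
apply: (iffP forallP) => [acy c c_gt2 /andP[cyc_c uniq_c] | acy k].
  have ltk : size c < #|V|.+1 by rewrite ltnS -(card_uniqP uniq_c) max_card.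
  have /forallP/(_ (in_tuple c)) := acy (Ordinal ltk).
  by rewrite /= c_gt2 uniq_c cyc_c.
apply/forallP => c; apply/negP => /and3P[k_gt2 uniq_c cyc_c].
by apply: (acy c); rewrite ?size_tuple // /ucycle cyc_c.
Qed.

(* A spanning subgraph is identified with its set of edges. *)
Definition spanning_tree (V : finType) (e : sgraph V) (F : {set {set V}}) :=
  [&& F \subset edges e, connectedb (edge_rel F) & acyclicb (edge_rel F)].

Definition num_spanning_trees (V : finType) (e : sgraph V) : nat :=
  #|[set F | spanning_tree e F]|.

Section CommutingGraph.

Variables (gT : finGroupType) (G : {group gT}).

Definition commuting_rel : rel (subg_of G) :=
  fun x y => (x != y) && (x * y == y * x)%g.

Lemma commuting_rel_sym : symmetric commuting_rel.
Proof. by move=> x y; rewrite /commuting_rel eq_sym [(y * x)%g == _]eq_sym. Qed.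

Lemma commuting_rel_irr : irreflexive commuting_rel.
Proof. by move=> x; rewrite /commuting_rel eqxx. Qed.

Definition commuting_graph : sgraph (subg_of G) :=
  SGraph commuting_rel_sym commuting_rel_irr.

Definition kappa : nat := num_spanning_trees commuting_graph.

End CommutingGraph.

(* Main.v *)
Require Import Defs.
From mathcomp Require Import all_boot all_order all_fingroup all_algebra all_solvable.
From mathcomp Require Import ring zify.

Set Implicit Arguments.
Unset Strict Implicit.
Unset Printing Implicit Defensive.

(** Since |G : Z(G)| = p^2, the centralizer of a noncentral element is abelian
of order mp, so commutation is an equivalence relation on G \ Z(G); its p + 1
classes have m(p - 1) elements. Hence the commuting graph is the join of K_m
with p + 1 disjoint copies of K_{m(p-1)}.

A spanning tree rooted at r is the same as a function sending each vertex
v <> r to a neighbour and whose iterates all reach r. Expanding the determinant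
of the reduced Laplacian multilinearly in its rows gives a sum over functions
f choosing a neighbour of each vertex, and the determinant attached to f is 1
or 0 according to whether the iterates of f reach r; so the determinant counts
the spanning trees. For the join above the Laplacian is a diagonal matrix plus
a matrix of rank at most p + 2, and det (1 - A B) = det (1 - B A) reduces its
determinant to that of an arrow matrix. *)

(** * Spanning trees and parent functions *)

Lemma set2_eq (T : finType) (x y a b : T) :
  [set x; y] = [set a; b] -> (x = a /\ y = b) \/ (x = b /\ y = a).
Proof.
move=> E.
have /set2P xab : x \in [set a; b] by rewrite -E set21.
have /set2P yab : y \in [set a; b] by rewrite -E set22.
have /set2P axy : a \in [set x; y] by rewrite E set21.
have /set2P bxy : b \in [set x; y] by rewrite E set22.
case: xab yab axy bxy => -> [->|->]; [|by left|by right|].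
  by move=> _ [->|->]; left.
by move=> [->|->] _; left.
Qed.

Section ParentFunctions.

Variable V : finType.
Implicit Types (e : sgraph V) (f g : {ffun V -> V}) (r : V).

(** Requiring [r] to be fixed pins down the one value that the tree does not determine, so that
    trees and functions correspond one to one. *)
Definition rooted r f := (f r == r) && [forall v, fconnect f v r].

Definition parent_fun e r f :=
  rooted r f && [forall v, (v != r) ==> e v (f v)].

Definition parent_edges r f : {set {set V}} :=
  [set [set v; f v] | v in [pred v | v != r]].

Lemma in_edges e x y : ([set x; y] \in edges e) = e x y.
Proof.
apply/imset2P/idP => [[a b _]|exy]; last by exists x y; rewrite ?inE.
by rewrite inE => /andP[_ eab] /set2_eq[[-> ->]|[-> ->]] //; rewrite adj_sym.
Qed.

Lemma parent_edgesP r f x y :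
  reflect ((x != r /\ y = f x) \/ (y != r /\ x = f y))
          (edge_rel (parent_edges r f) x y).
Proof.
apply: (iffP imsetP) => [[v]|]; rewrite ?inE.
  by move=> vr /set2_eq[[-> ->]|[-> ->]]; [left | right].
case=> -[zr ->]; first by exists x.
by exists y; rewrite ?inE // setUC.
Qed.

Lemma edge_rel_sym (F : {set {set V}}) : symmetric (edge_rel F).
Proof. by move=> x y; rewrite /edge_rel setUC. Qed.

(** If [v] has depth [d], then [d * k.+1] steps return [v] to itself, yet they also pass through
    [r], which is fixed. *)
Lemma rooted_iter_fix r f v k : rooted r f -> iter k.+1 f v = v -> v = r.
Proof.
case/andP=> /eqP fr /forallP/(_ v) /iter_findex.
set d := findex _ _ _ => dr loop.
have fixr j : iter j f r = r by elim: j => //= j ->.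
have loopj j : iter (j * k.+1) f v = v.
  by elim: j => // j IHj; rewrite mulSn iterD IHj.
by rewrite -(loopj d) mulnS addnC iterD dr fixr.
Qed.

Lemma rooted_induct r f (P : V -> Prop) :
  rooted r f -> P r -> (forall v, v != r -> P (f v) -> P v) -> forall v, P v.
Proof.
case/andP=> _ /forallP con Pr IH v.
have: iter (findex f v r) f v = r by apply: iter_findex.
move: (findex f v r) => d.
elim: d v => [|d IHd] v; first by move=> /= ->.
rewrite iterSr => /IHd Pfv.
by have [-> //|vr] := eqVneq v r; apply: IH.
Qed.

Lemma parent_edges_connected r f :
  rooted r f -> connectedb (edge_rel (parent_edges r f)).
Proof.
move=> rf; set E := edge_rel _.
have toroot v : connect E v r.
  move: v; apply: (rooted_induct rf) => // v vr; apply: connect_trans.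
  by apply: connect1; apply/parent_edgesP; left.
apply/forallP => x; apply/forallP => y.
apply: connect_trans (toroot x) _.
by rewrite (sym_connect_sym (@edge_rel_sym _)).
Qed.

(* A vertex of maximal depth on a cycle would have its parent as both of its
   neighbours. *)
Lemma parent_edges_acyclic r f :
  rooted r f -> acyclicb (edge_rel (parent_edges r f)).
Proof.
move=> rf; apply/acyclicP => c c_gt2 /andP[cyc uni].
have con v : fconnect f v r by case/andP: rf => _ /forallP/(_ v).
pose dep v := findex f v r.
have depS v : v != r -> dep v = (dep (f v)).+1.
  by move=> vr; rewrite /dep fconnect_findex // eq_sym.
have [x0 x0c] : exists x, x \in c.
  by case: (c) c_gt2 => // x s _; exists x; rewrite mem_head.
have [x xc xmax] := @arg_maxnP _ x0 (mem c) dep x0c.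
have nbr u : u \in c -> edge_rel (parent_edges r f) x u -> u = f x.
  move=> uc /parent_edgesP[[] //|[ur xE]].
  by have := xmax u uc; rewrite /= (depS u ur) -xE ltnn.
have [i s rotE] := rot_to xc.
have sc u : u \in s -> u \in c.
  by move=> us; rewrite -(mem_rot i) rotE inE us orbT.
move: cyc uni c_gt2; rewrite -(rot_cycle i) -(rot_uniq i) -(size_rot i) rotE.
case: s sc {rotE} => [|y [|z s]] // sc /= /andP[exy].
rewrite rcons_path => /andP[_ /andP[_ exl]] /and3P[_ yzs _] _.
move: exl; rewrite edge_rel_sym => /nbr lE.
have lz : last z s \in z :: s by apply: mem_last.
move: yzs; rewrite (nbr y _ exy) ?sc ?mem_head //.
by rewrite -lE ?lz // sc // inE lz orbT.
Qed.

(** Induction outward from the root: the edge from [v] to [g v] comes from [f] as well, so either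
    [f v = g v], or [f (g v) = v]. In the second case the induction hypothesis at [g v] makes [v] a
    point of period 2 of [g], which forces [v = r]. *)
Lemma parent_edges_inj r : {in rooted r &, injective (parent_edges r)}.
Proof.
move=> f g rf rg eqE.
have [/eqP fr _] := andP rf; have [/eqP gr _] := andP rg.
suff P v : f v = g v by apply/ffunP.
apply/eqP; move: v; apply: (rooted_induct rg) => [|v vr IH]; first by rewrite fr gr.
have : edge_rel (parent_edges r f) v (g v).
  by rewrite eqE; apply/parent_edgesP; left.
case/parent_edgesP=> [[_ ->] //|[gvr vE]].
have /eqP := IH; rewrite -vE => ggv.
by case/eqP: vr; apply: (@rooted_iter_fix _ g v 1).
Qed.

(** Each vertex takes as parent a neighbour strictly closer to [r]; [d] below is the distance to
    [r]. *)
Lemma exists_rooted (e : rel V) r :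
  (forall v, connect e v r) ->
  exists2 f, rooted r f & forall v, v != r -> e v (f v).
Proof.
move=> con.
pose P v k := [exists p : k.-tuple V, path e v p && (last v p == r)].
have exP v : exists k, P v k.
  have /connectP[p pp rE] := con v.
  by exists (size p); apply/existsP; exists (in_tuple p); rewrite /= pp -rE eqxx.
pose d v := ex_minn (exP v).
have step v : v != r -> exists u, e v u && (d u < d v).
  move=> vr; rewrite {2}/d; case: ex_minnP => k /existsP[p /andP[]] + + _.
  case: k p => [|k] p; first by rewrite tuple0 /= (negPf vr).
  case/tupleP: p => u p /= /andP[evu pp] lp; exists u; rewrite evu ltnS.
  rewrite /d; case: ex_minnP => j _; apply.
  by apply/existsP; exists p; rewrite pp.
pose f := [ffun v => if v == r then r else odflt r [pick u | e v u && (d u < d v)]].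
have fr : f r = r by rewrite ffunE eqxx.
have fP v : v != r -> e v (f v) && (d (f v) < d v).
  move=> vr; rewrite ffunE (negPf vr); case: pickP => //= no.
  by have [u] := step v vr; rewrite no.
exists f => [|v /fP/andP[] //]; rewrite /rooted fr eqxx; apply/forallP => v.
have [n] := ubnP (d v); elim: n v => // n IHn v; rewrite ltnS => dv.
have [-> //|/fP/andP[_ dfv]] := eqVneq v r.
exact: connect_trans (fconnect1 f v) (IHn _ (leq_trans dfv dv)).
Qed.

(* Any further edge of the tree would close a cycle with the path joining its
   ends along the parent edges. *)
Lemma parent_edges_onto e r F :
  spanning_tree e F -> exists2 f, parent_fun e r f & F = parent_edges r f.
Proof.
case/and3P=> sFe con /acyclicP acy.
have [v|f rf Ff] := @exists_rooted (edge_rel F) r.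
  by move/forallP/(_ v)/forallP/(_ r): con.
have Fe x y : edge_rel F x y -> e x y by move/(subsetP sFe); rewrite in_edges.
exists f.
  by rewrite /parent_fun rf; apply/forallP => v; apply/implyP => /Ff/Fe.
have sfF : subrel (edge_rel (parent_edges r f)) (edge_rel F).
  move=> x y /parent_edgesP[[xr ->]|[yr ->]]; first exact: Ff.
  by rewrite edge_rel_sym; apply: Ff.
apply/eqP; rewrite eqEsubset; apply/andP; split; last first.
  by apply/subsetP => _ /imsetP[v vr ->]; apply: Ff.
apply/subsetP => E EF; have /imset2P[x y _ _ defE] := subsetP sFe E EF.
subst E; apply: contraT => nE.
have xy : x != y.
  by apply: contraTneq (Fe _ _ EF) => <-; rewrite adj_irr.
have := parent_edges_connected rf.
move/forallP/(_ x)/forallP/(_ y)/connectP => [p0 pp0 yE].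
case/shortenP: pp0 yE => p pp up _ yE.
exfalso; apply: (acy (x :: p)).
  case: p pp yE {up} => [_ /eqP|z [|//]]; first by rewrite eq_sym (negPf xy).
  by rewrite /= andbT => Exz yz; case/negP: nE; rewrite yz.
rewrite /ucycle up andbT /= rcons_path (sub_path sfF pp) /= -yE.
by rewrite edge_rel_sym.
Qed.

Lemma num_spanning_trees_parent_fun e r :
  num_spanning_trees e = #|[set f | parent_fun e r f]|.
Proof.
rewrite -(card_in_imset (f := parent_edges r)); last first.
  by move=> f g; rewrite !inE => /andP[+ _] /andP[+ _]; apply: parent_edges_inj.
apply: eq_card => F; rewrite inE; apply/idP/imsetP.
  by case/(parent_edges_onto r) => f ef ->; exists f; rewrite ?inE.
case=> f; rewrite inE => /andP[rf /forallP ef] ->.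
rewrite /spanning_tree parent_edges_connected // parent_edges_acyclic // !andbT.
apply/subsetP => _ /imsetP[v vr ->]; rewrite in_edges.
exact: (implyP (ef v)).
Qed.

End ParentFunctions.

(** * Determinant of the Laplacian *)

Section LaplacianDeterminant.

Import GRing.Theory Num.Theory.
Local Open Scope ring_scope.

Definition fmx (R : Type) (V : finType) (a : V -> V -> R) : 'M[R]_#|V| :=
  \matrix_(i, j) a (enum_val i) (enum_val j).

Lemma big_enum_val_type (T : Type) (x : T) (op : SemiGroup.com_law T)
    (V : finType) (h : V -> T) :
  \big[op/x]_(i < #|V|) h (enum_val i) = \big[op/x]_v h v.
Proof. by rewrite [RHS](reindex _ (onW_bij _ (enum_val_bij V))). Qed.

(** In each Leibniz term the product over rows of sums distributes into a sum over functions [f]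
    choosing one summand per row. *)
Lemma det_fmx_row_sum (R : comPzRingType) (V I : finType)
    (a : V -> I -> R) (b : V -> I -> V -> R) :
  \det (fmx (fun v w => \sum_i a v i * b v i w)) =
    \sum_(f : {ffun V -> I})
       (\prod_v a v (f v)) * \det (fmx (fun v => b v (f v))).
Proof.
rewrite /determinant.
under [RHS]eq_bigr do rewrite mulr_sumr.
rewrite exchange_big; apply: eq_bigr => s _ /=.
under [RHS]eq_bigr do rewrite mulrCA; rewrite -mulr_sumr; congr (_ * _).
pose t v := enum_val (s (enum_rank v)).
transitivity (\prod_v \sum_i a v i * b v i (t v)).
  by rewrite -[RHS]big_enum_val_type; apply: eq_bigr => i _; rewrite mxE /t enum_valK.
rewrite bigA_distr_bigA; apply: eq_bigr => f _ /=.
rewrite big_split /=; congr (_ * _).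
rewrite -[LHS]big_enum_val_type; apply: eq_bigr => i _.
by rewrite mxE /t enum_valK.
Qed.

Definition parent_mx (R : pzRingType) (V : finType) (r : V) (f : V -> V) :=
  fmx (fun v w => (v == w)%:R - ((v != r) && (f v == w))%:R : R).

(** If some vertex misses [r], the indicator of all such vertices is a nonzero kernel vector.
    Otherwise only the identity contributes to the Leibniz sum, and its diagonal is 1. *)
Lemma det_parent_mx (R : idomainType) (V : finType) (r : V) (f : {ffun V -> V}) :
  f r = r -> \det (parent_mx R r f) = (rooted r f)%:R.
Proof.
move=> fr; case: (boolP (rooted r f)) => [rf|]; last first.
  rewrite /rooted fr eqxx => /forallPn[v0 nv0].
  apply/eqP; rewrite -det_tr; apply/det0P.
  exists (\row_i (~~ fconnect f (enum_val i) r)%:R).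
    apply/eqP => /rowP/(_ (enum_rank v0))/eqP.
    by rewrite !mxE enum_rankK nv0 oner_eq0.
  apply/rowP => i; rewrite !mxE; set v := enum_val i.
  pose w u : R := (~~ fconnect f u r)%:R.
  transitivity (\sum_u w u * ((v == u)%:R - ((v != r) && (f v == u))%:R)).
    by rewrite -[RHS]big_enum_val_type; apply: eq_bigr => j _; rewrite !mxE.
  under eq_bigr do rewrite mulrBr.
  rewrite big_split /= sumrN (bigD1 v) //= eqxx mulr1 big1 ?addr0; last first.
    by move=> u; rewrite eq_sym => /negPf->; rewrite mulr0.
  rewrite (bigD1 (f v)) //= eqxx andbT big1 ?addr0; last first.
    by move=> u; rewrite eq_sym => /negPf->; rewrite andbF mulr0.
  have [->|vr] := eqVneq v r; first by rewrite mulr0 subr0 /w connect0.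
  rewrite mulr1 /w; apply/eqP; rewrite subr_eq0; apply/eqP.
  congr ((~~ _)%:R); apply/idP/idP => [|]; last exact: connect_trans (fconnect1 f v).
  move=> c; rewrite -(iter_findex c) (fconnect_findex c) 1?eq_sym // iterSr.
  exact: fconnect_iter.
rewrite /determinant (bigD1 1%g) //= [X in _ + X]big1 ?addr0 => [|s].
  rewrite odd_perm1 expr0 mul1r big1 // => i _; rewrite mxE perm1 eqxx.
  set v := enum_val i; have [|vr] := eqVneq v r; first by rewrite subr0.
  case: eqP => [fv|_]; last by rewrite subr0.
  by case/eqP: vr; apply: (@rooted_iter_fix _ r f v 0).
apply: contraNeq; rewrite mulf_eq0 signr_eq0 /= => /prodf_neq0 nz.
pose t v := enum_val (s (enum_rank v)).
have nzt v : (v == t v)%:R != ((v != r) && (f v == t v))%:R :> R.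
  by have := nz (enum_rank v) isT; rewrite mxE enum_rankK subr_eq0.
have tinj : injective t.
  by move=> u v /enum_val_inj/perm_inj/enum_rank_inj.
(* A nonzero term has [t v] equal to [v] or [f v]. If [t] fixes [f v], then [t v = f v] gives
   [f v = v] by injectivity, so [t] fixes [v] too. *)
have tid v : t v = v.
  move: v; apply: (rooted_induct rf) => [|v vr tfv].
    by have := nzt r; case: (r =P t r) => [//|_]; rewrite !eqxx.
  have := nzt v; rewrite vr -tfv /=.
  case: (v =P t v) => [//|_]; case: (t (f v) =P t v) => [/tinj fv|].
    by rewrite -fv tfv.
  by rewrite eqxx.
apply/eqP/permP => i; rewrite perm1; apply: enum_val_inj.
by rewrite -[RHS]tid /t enum_valK.
Qed.

(** Both sides equal the determinant of the block matrix with rows (1, A) and (B, 1), factored into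
    block triangular matrices in two ways. *)
Lemma det_sylvester (R : comNzRingType) m n (A : 'M[R]_(m, n)) (B : 'M_(n, m)) :
  \det (1%:M - A *m B) = \det (1%:M - B *m A).
Proof.
have := det_ublock (1%:M - A *m B) A 1%:M; rewrite det1 mulr1 => <-.
have := det_lblock 1%:M B (1%:M - B *m A); rewrite det1 mul1r => <-.
have detL : \det (block_mx 1%:M 0 B 1%:M : 'M[R]_(m + n)) = 1.
  by rewrite det_lblock !det1 mulr1.
have detU : \det (block_mx 1%:M A 0 1%:M : 'M[R]_(m + n)) = 1.
  by rewrite det_ublock !det1 mulr1.
rewrite -[LHS]mulr1 -[X in _ * X = _]detL -[RHS]mulr1 -[X in _ = _ * X]detU.
rewrite -!det_mulmx.
rewrite !mulmx_block !(mulmx1, mul1mx, mul0mx, mulmx0, addr0, add0r).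
by rewrite subrK addrC subrK.
Qed.

(* The Laplacian with the row of r replaced by a unit row: its determinant is
   that of the reduced Laplacian. *)
Definition rooted_laplacian (R : pzRingType) (V : finType) (e : sgraph V) (r : V) :=
  fmx (fun v w => if v == r then (v == w)%:R
                  else #|e v|%:R * (v == w)%:R - (e v w)%:R : R).

Lemma matrix_tree (R : idomainType) (V : finType) (e : sgraph V) (r : V) :
  \det (rooted_laplacian R e r) = (num_spanning_trees e)%:R.
Proof.
(* Off [r], the row of [v] is the sum over neighbours [u] of the unit row at [v] minus that at [u].
   At [r] the only choice is [r] itself. *)
pose a v u : R := (if v == r then u == r else e v u)%:R.
pose b v u w : R := (v == w)%:R - ((v != r) && (u == w))%:R.
have -> : rooted_laplacian R e r = fmx (fun v w => \sum_u a v u * b v u w).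
  apply/matrixP => i j; rewrite !mxE /a /b.
  move: (enum_val i) (enum_val j) => v w; have [->|vr] := eqVneq v r.
    rewrite (bigD1 r) //= eqxx mul1r subr0 big1 ?addr0 // => u /negPf->.
    by rewrite mul0r.
  under eq_bigr do rewrite mulrBr; rewrite big_split /= sumrN -mulr_suml.
  congr (_ * _ - _); first by rewrite -natr_sum -big_mkcond sum1_card.
  rewrite (bigD1 w) //= eqxx mulr1 big1 ?addr0 // => u /negPf->.
  by rewrite mulr0.
rewrite det_fmx_row_sum (num_spanning_trees_parent_fun e r) -sum1_card.
rewrite natr_sum [RHS]big_mkcond /=; apply: eq_bigr => f _; rewrite inE.
have [fr|fr] := eqVneq (f r) r; last first.
  rewrite /parent_fun /rooted (negPf fr) (bigD1 r) //= /a eqxx (negPf fr).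
  by rewrite !mul0r.
rewrite [\det _](det_parent_mx R fr) /parent_fun.
case: (rooted r f); rewrite ?mulr0 // mulr1 /=; case: forallP => [ef|nef].
  rewrite big1 // => v _; rewrite /a; have [->|vr] := eqVneq v r.
    by rewrite fr eqxx.
  by rewrite (implyP (ef v)).
apply/eqP/prodf_eq0; case: (pickP [pred v | (v != r) && ~~ e v (f v)]) => [v|no].
  by move=> /andP[vr nv]; exists v; rewrite // /a (negPf vr) (negPf nv).
case: nef => v; apply/implyP => vr.
by have := no v; rewrite /= vr => /negbFE.
Qed.

(** * Spanning trees of a clique joined to disjoint equal cliques *)

(** Column operations clear the lower left block and leave the Schur complement in the corner. *)
Lemma det_block_scalar (F : fieldType) k (a s : F) (b : 'rV_k) (c : 'cV_k) :
  s != 0 ->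
  \det (block_mx a%:M b c s%:M : 'M_(1 + k)) =
    (a - (b *m c) 0 0 / s) * s ^+ k.
Proof.
move=> s0.
have detL : \det (block_mx 1%:M 0 (- s^-1 *: c) 1%:M : 'M[F]_(1 + k)) = 1.
  by rewrite det_lblock !det1 mulr1.
rewrite -[LHS]mulr1 -[X in _ * X = _]detL -det_mulmx mulmx_block.
rewrite !(mulmx1, mulmx0, addr0, add0r) mul_scalar_mx scalerA mulrN divff //.
rewrite scaleN1r subrr det_ublock det_scalar det_mx11 -scalemxAr.
by rewrite !mxE eqxx mulr1n mulNr [_ * s^-1]mulrC.
Qed.

(** With n vertices in all, the nonzero Laplacian eigenvalues of this join are n, [#|Z| + q.+1] and
    [#|Z|], with multiplicities [#|Z|], [k.+1 * q] and [k]; the formula is their product divided by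
    n. *)
Lemma num_spanning_trees_clique_join (V : finType) (e : sgraph V) (Z : {set V})
    (k q : nat) (c : V -> 'I_k.+1) :
  (0 < #|Z|)%N ->
  (forall x y, e x y = (x != y) && [|| x \in Z, y \in Z | c x == c y]) ->
  (forall i, #|[set x | (x \notin Z) && (c x == i)]| = q.+1) ->
  num_spanning_trees e =
    ((#|Z| + k.+1 * q.+1) ^ #|Z|.-1 * (#|Z| + q.+1) ^ (k.+1 * q) * #|Z| ^ k)%N.
Proof.
move=> /card_gt0P[r rZ] eE cardc.
set m := #|Z|; set n := (m + k.+1 * q.+1)%N; set d := (m + q.+1)%N.
have m_gt0 : (0 < m)%N by apply/card_gt0P; exists r.
have cardZc : #|~: Z| = (k.+1 * q.+1)%N.
  rewrite -sum1_card (partition_big c xpredT) //=.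
  rewrite -[k.+1 in RHS]card_ord -sum_nat_const; apply: eq_bigr => i _.
  by rewrite -(cardc i) -sum1_card; apply: eq_bigl => x; rewrite !inE.
have cardV : #|V| = n by rewrite -(cardsC Z) cardZc.
have deg v : #|e v|.+1 = (if v \in Z then n else d).
  have -> : #|e v|.+1 = #|[set w | [|| v \in Z, w \in Z | c v == c w]]|.
    rewrite [RHS](cardsD1 v) inE eqxx !orbT add1n; congr _.+1.
    by apply: eq_card => w; rewrite !inE [LHS]eE eq_sym.
  case: ifP => vZ; first by rewrite -cardV; apply: eq_card => w; rewrite !inE.
  rewrite -(cardsID Z) /d; congr (_ + _)%N.
    by apply: eq_card => w; rewrite !inE andbC; case: (w \in Z).
  rewrite -(cardc (c v)); apply: eq_card => w; rewrite !inE eq_sym.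
  by case: (w \in Z).
apply/eqP; rewrite -(eqr_nat rat) -(matrix_tree _ _ r); apply/eqP.
(* The rooted Laplacian is D (1 - Q W): Q records the class of a vertex (Z or a
   fibre of c), scaled by D^-1, and W which classes a vertex is adjacent to.
   The swapped product W Q is indexed by the k + 2 classes only. *)
pose D v : rat := if v == r then 1 else if v \in Z then n%:R else d%:R.
pose Q0 v : rat := ((v != r) && (v \in Z))%:R / n%:R.
pose Q1 v i : rat := ((v \notin Z) && (c v == i))%:R / d%:R.
pose W1 i w : rat := ((w \in Z) || (c w == i))%:R.
have n0 : n%:R != 0 :> rat by rewrite pnatr_eq0 -lt0n addn_gt0 m_gt0.
have d0 : d%:R != 0 :> rat by rewrite pnatr_eq0 -lt0n addn_gt0 m_gt0.
have m0 : m%:R != 0 :> rat by rewrite pnatr_eq0 -lt0n.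
pose mQ : 'M_(#|V|, 1 + k.+1) :=
  row_mx (\col_i Q0 (enum_val i)) (\matrix_(i, j) Q1 (enum_val i) j).
pose mW : 'M_(1 + k.+1, #|V|) :=
  col_mx (const_mx 1) (\matrix_(i, j) W1 i (enum_val j)).
(* Off [r], [D] is the degree plus one, since the product of the class matrices includes the
   diagonal of the closed adjacency relation. The row of [mQ] at [r] vanishes, which leaves the unit
   row. *)
have -> : rooted_laplacian _ e r =
    diag_mx (\row_i D (enum_val i)) *m (1%:M - mQ *m mW).
  apply/matrixP => i j; rewrite mul_diag_mx !mxE big_split_ord /= big_ord1.
  rewrite row_mxEl col_mxEu !mxE mulr1.
  under eq_bigr do rewrite row_mxEr col_mxEd !mxE.
  rewrite -(inj_eq enum_val_inj).
  move: (enum_val i) (enum_val j) => v w.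
  rewrite (bigD1 (c v)) //= big1 => [|l lv]; last first.
    by rewrite /Q1 eq_sym (negPf lv) andbF !mul0r.
  rewrite addr0 /D /Q0 /Q1 /W1 eqxx andbT.
  have [->|vr] := eqVneq v r; first by rewrite rZ !mul0r !subr0 mul1r.
  have degR : #|e v|%:R = (if v \in Z then n else d)%:R - 1 :> rat.
    by rewrite -deg -natr1 addrK.
  rewrite eE degR [c w == _]eq_sym; case: (boolP (v \in Z)) => vZ /=.
    by rewrite andbT; case: (v == w) => /=; field; rewrite n0 d0.
  have [<-|_] := eqVneq v w; first by rewrite eqxx orbT /=; field; rewrite n0 d0.
  by case: (_ || _) => /=; field; rewrite n0 d0.
rewrite det_mulmx det_diag det_sylvester.
have -> : \prod_(i < #|V|) (\row_j D (enum_val j)) 0 i =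
    n%:R ^+ m.-1 * d%:R ^+ (k.+1 * q.+1).
  under eq_bigr do rewrite mxE; rewrite big_enum_val_type.
  rewrite (bigID (mem Z)) /=; congr (_ * _).
    rewrite (bigD1 r) //= {1}/D eqxx mul1r.
    rewrite (eq_bigr (fun _ => n%:R)) => [|v /andP[vZ vr]]; last first.
      by rewrite /D (negPf vr) vZ.
    rewrite prodr_const; congr (_ ^+ _); rewrite /m (cardsD1 r Z) rZ /=.
    by apply: eq_card => v; rewrite !inE andbC.
  rewrite (eq_bigr (fun _ => d%:R)) => [|v vZ]; last first.
    by rewrite /D (negPf vZ); case: eqP vZ => // ->; rewrite rZ.
  rewrite prodr_const -cardZc; congr (_ ^+ _).
  by apply: eq_card => v; rewrite !inE.
have sumP (g : V -> rat) (P : pred V) (x y : rat) :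
    (forall v, P v -> g v = y) ->
  \sum_v g v * ((P v)%:R / x) = y * (#|P|%:R / x).
  move=> gy; rewrite -sum1_card natr_sum mulr_suml mulr_sumr [RHS]big_mkcond /=.
  apply: eq_bigr => v _; rewrite unfold_in.
  by case: (boolP (P v)) => [/gy->|_]; rewrite ?mul0r ?mulr0.
have cardQ0 : #|[pred v | (v != r) && (v \in Z)]| = m.-1.
  by rewrite /m (cardsD1 r Z) rZ /=; apply: eq_card => v; rewrite !inE.
have cardQ1 i : #|[pred v | (v \notin Z) && (c v == i)]| = q.+1.
  by rewrite -(cardc i) cardsE.
(* The count is [m.-1] because [Q0] omits [r]. The lower right block is scalar because distinct
   fibres of [c] outside [Z] are not adjacent. *)
have -> : mW *m mQ = block_mx (m.-1%:R / n%:R)%:M (const_mx (q.+1%:R / d%:R))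
    (const_mx (m.-1%:R / n%:R)) (q.+1%:R / d%:R)%:M.
  rewrite mul_col_row.
  have sumE (g h : V -> rat) : \sum_(i < #|V|) g (enum_val i) * h (enum_val i)
      = \sum_v g v * h v.
    by rewrite -[RHS]big_enum_val_type.
  congr block_mx; apply/matrixP => i j; rewrite !mxE; under eq_bigr do rewrite !mxE.
  - rewrite (sumE (fun=> 1) Q0) (sumP _ _ _ 1) // cardQ0 mul1r.
    by rewrite !ord1 mulr1n.
  - by rewrite (sumE (fun=> 1) (Q1^~ j)) (sumP _ _ _ 1) // cardQ1 mul1r.
  - rewrite (sumE (W1 i) Q0) (sumP _ _ _ 1) ?cardQ0 ?mul1r // => v /andP[_ vZ].
    by rewrite /W1 vZ.
  rewrite (sumE (W1 i) (Q1^~ j)) (sumP _ _ _ (i == j)%:R).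
    by rewrite cardQ1 mulr_natl.
  by move=> v /andP[vZ /eqP<-]; rewrite /W1 (negPf vZ) eq_sym.
rewrite scalar_mx_block opp_block_mx add_block_mx !add0r -!raddfB /=.
have sE : 1 - q.+1%:R / d%:R = m%:R / d%:R :> rat.
  by apply: (mulIf d0); rewrite mulrBl !divfK // mul1r /d natrD addrK.
rewrite sE det_block_scalar; last by rewrite mulf_neq0 ?invr_eq0.
rewrite mxE; under eq_bigr do rewrite !mxE.
rewrite sumr_const card_ord mulrNN.
(* Since n - m = (k+1)(q+1), this Schur complement is 1 - ((m-1)/n)(n/m) = 1/m. *)
have -> : 1 - m.-1%:R / n%:R - (q.+1%:R / d%:R * (m.-1%:R / n%:R)) *+ k.+1
    / (m%:R / d%:R) = m%:R^-1 :> rat.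
  have mE : m.-1%:R = m%:R - 1 :> rat by rewrite -[in RHS](prednK m_gt0) -natr1 addrK.
  have nE : n%:R = m%:R + k.+1%:R * q.+1%:R :> rat by rewrite natrD natrM.
  by rewrite -mulr_natr mE; field: nE; rewrite n0 d0 m0.
rewrite mulnS exprD expr_div_n [m%:R ^+ k.+1]exprS !natrM !natrX.
have := expf_neq0 k.+1 d0; move: (d%:R ^+ k.+1) => X X0.
by move: (n%:R ^+ _) (d%:R ^+ _) (m%:R ^+ k) => *; field; rewrite X0 m0.
Qed.
End LaplacianDeterminant.

(** * Centralizers in a group whose center has index p^2 *)

Section Centralizers.
Import GroupScope.

Variables (gT : finGroupType) (G : {group gT}) (p : nat).
Hypotheses (p_pr : prime p) (index_center : #|G : 'Z(G)| = (p ^ 2)%N).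

Lemma center_sub_cent1 x : x \in G -> 'Z(G) \subset 'C_G[x].
Proof.
move=> xG; apply/subsetP => z /centerP[zG zC].
by apply/subcent1P; split => //; apply/commute_sym/zC.
Qed.

(** The centralizer lies strictly between the center and [G], so its index over the center is a
    divisor of p^2 other than 1 and p^2. *)
Lemma card_noncentral_cent1 x :
  x \in G :\: 'Z(G) -> #|'C_G[x]| = (#|'Z(G)| * p)%N.
Proof.
move=> /setDP[xG xZ]; have sZC := center_sub_cent1 xG.
have sCG : 'C_G[x] \subset G by apply: subcent1_sub.
have := Lagrange_index sCG sZC; rewrite index_center => idx.
have CZ1 : #|'C_G[x] : 'Z(G)| != 1%N.
  rewrite indexg_eq1; apply: contra xZ => /subsetP; apply.
  by apply/subcent1P.
have GC1 : #|G : 'C_G[x]| != 1%N.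
  rewrite indexg_eq1; apply: contra xZ => /subsetP sGC; apply/centerP.
  by split=> // y /sGC/subcent1P[].
have /(dvdn_pfactor _ _ p_pr)[j j2 CZE] : #|'C_G[x] : 'Z(G)| %| p ^ 2.
  by rewrite -idx dvdn_mull.
have p_gt0 := prime_gt0 p_pr.
rewrite -(Lagrange sZC) CZE.
case: j j2 CZE => [|[|[|]]] //= _ CZE; rewrite CZE in idx CZ1.
  by case/eqP: CZ1.
case/eqP: GC1; apply/eqP; rewrite -(eqn_pmul2r (m := p ^ 2)) ?mul1n ?expn_gt0 ?p_gt0 //.
exact/eqP.
Qed.

(** The quotient of the centralizer by the central subgroup ['Z(G)] has order p, hence is cyclic. *)
Lemma abelian_noncentral_cent1 x : x \in G :\: 'Z(G) -> abelian 'C_G[x].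
Proof.
move=> xGZ; have /setDP[xG _] := xGZ; have sZC := center_sub_cent1 xG.
have sZZ : 'Z(G) \subset 'Z('C_G[x]).
  by rewrite subsetI sZC (subset_trans (subsetIr _ _)) // centS // subcent1_sub.
apply: (cyclic_factor_abelian sZZ); apply: prime_cyclic.
rewrite card_quotient; last first.
  by apply: (subset_trans _ (normal_norm (center_normal G))); apply: subcent1_sub.
by rewrite -divgS // (card_noncentral_cent1 xGZ) mulKn // cardG_gt0.
Qed.

(** If [y] lies in the abelian group ['C_G[x]], then ['C_G[x]] is contained in ['C_G[y]], and the
    orders agree. *)
Lemma commute_cent1_eq x y : x \in G :\: 'Z(G) -> y \in G :\: 'Z(G) ->
  (x * y == y * x) = ('C_G[x] == 'C_G[y]).
Proof.
move=> xGZ yGZ; have /setDP[xG _] := xGZ; have /setDP[yG _] := yGZ.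
apply/eqP/eqP => [cxy|Exy].
  apply/eqP; rewrite eqEcard !card_noncentral_cent1 // leqnn andbT.
  have yCx : y \in 'C_G[x] by apply/subcent1P.
  have := abelian_noncentral_cent1 xGZ; rewrite abelianE => /subsetP/(_ y yCx).
  by rewrite subsetI subcent1_sub sub_cent1.
by have /subcent1P[] : y \in 'C_G[x]; rewrite ?Exy //; apply/subcent1P.
Qed.

Lemma cent1_fiber x : x \in G :\: 'Z(G) ->
  [set y in G :\: 'Z(G) | 'C_G[y] == 'C_G[x]] = 'C_G[x] :\: 'Z(G).
Proof.
move=> xGZ; apply/setP => y.
rewrite in_set [RHS]in_setD; have [yGZ|] /= := boolP (y \in G :\: 'Z(G)).
  have /setDP[yG yZ] := yGZ; rewrite -(commute_cent1_eq yGZ xGZ) yZ /=.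
  by apply/eqP/subcent1P => [E|[_ ->]].
rewrite in_setD negb_and => /orP[/negPf->//|yG].
by rewrite [_ \in 'C__[_]]inE (negPf yG) andbF.
Qed.

Lemma card_cent1_fiber x : x \in G :\: 'Z(G) ->
  #|[set y in G :\: 'Z(G) | 'C_G[y] == 'C_G[x]]| = (#|'Z(G)| * p.-1)%N.
Proof.
move=> xGZ; have /setDP[xG _] := xGZ.
rewrite (cent1_fiber xGZ) cardsD (setIidPr (center_sub_cent1 xG)).
by rewrite (card_noncentral_cent1 xGZ) -subn1 mulnBr muln1.
Qed.

(** With m the order of the center, the m(p^2 - 1) noncentral elements split into fibres of size m(p
    - 1). *)
Lemma card_noncentral_cent1s : #|[set 'C_G[x] | x in G :\: 'Z(G)]| = p.+1.
Proof.
have p_gt1 := prime_gt1 p_pr.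
have m_gt0 : 0 < #|'Z(G)| by apply: cardG_gt0.
have cardGZ : #|G :\: 'Z(G)| = (#|'Z(G)| * (p ^ 2).-1)%N.
  rewrite cardsD (setIidPr (center_sub G)) -(Lagrange (center_sub G)) index_center.
  by rewrite -subn1 mulnBr muln1.
have : #|G :\: 'Z(G)| =
    (#|[set 'C_G[x] | x in G :\: 'Z(G)]| * (#|'Z(G)| * p.-1))%N.
  rewrite -sum1_card (partition_big_imset (fun x => 'C_G[x])) -sum_nat_const.
  apply: eq_bigr => _ /imsetP[x xGZ ->]; rewrite -(card_cent1_fiber xGZ).
  by rewrite -sum1_card; apply: eq_bigl => y; rewrite !inE.
rewrite cardGZ => /eqP; rewrite mulnCA eqn_pmul2l // => /eqP E.
apply/eqP; rewrite -(eqn_pmul2r (m := p.-1)) -?E; last by lia.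
by apply/eqP; nia.
Qed.

End Centralizers.

(** * The commuting graph as a join of cliques *)

Theorem theorem4p4 (gT : finGroupType) (G : {group gT}) (n m p : nat)
  (cardG : #|G| = n)
  (cardZ : #|('Z(G))%g| = m)
  (ntZ : ('Z(G) != 1)%g)
  (p_pr : prime p)
  (quoG : (G / 'Z(G) \isog [set: 'Z_p * 'Z_p])%g) :
  kappa G = p ^ (n + m - p - 3) * m ^ (n - 2).
Proof.
have p_gt1 := prime_gt1 p_pr.
have idx : #|G : 'Z(G)|%g = p ^ 2.
  rewrite -card_quotient ?normal_norm ?center_normal // (card_isog quoG).
  by rewrite cardsT card_prod card_ord Zp_cast.
have m_gt1 : 1 < m by rewrite -cardZ cardG_gt1.
have nE : n = m * p ^ 2 by rewrite -cardG -(Lagrange (center_sub G)) idx cardZ.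
set K := [set 'C_G[x]%g | x in G :\: 'Z(G)%g].
have cardK : #|K| = p.+1 := card_noncentral_cent1s p_pr idx.
(* For central x the index is out of range and c x is a junk value. *)
pose c (x : subg_of G) : 'I_p.+1 := inord (index 'C_G[val x]%g (enum K)).
have noncentral (x : subg_of G) : val x \notin 'Z(G)%g -> val x \in G :\: 'Z(G)%g.
  by move=> xZ; apply/setDP; split; first exact: subgP.
have cent1K (x : subg_of G) : val x \notin 'Z(G)%g -> 'C_G[val x]%g \in enum K.
  by move=> /noncentral xGZ; rewrite mem_enum; apply: imset_f.
have ltK (C : {set gT}) : C \in enum K -> index C (enum K) < p.+1.
  by rewrite -index_mem -cardE cardK.
have cE x i : val x \notin 'Z(G)%g ->
    (c x == i) = ('C_G[val x]%g == nth set0 (enum K) i).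
  move=> /cent1K xK; rewrite -val_eqE /= inordK ?ltK //.
  apply/eqP/eqP => [<-|->]; first by rewrite nth_index.
  by rewrite index_uniq ?enum_uniq // -cardE cardK.
have card_subg (P : pred gT) : #|[set x : subg_of G | P (val x)]| = #|[set y in G | P y]|.
  rewrite -(card_imset _ val_inj); apply: eq_card => y; apply/imsetP/idP.
    by case=> x; rewrite !inE => Px ->; rewrite subgP.
  rewrite inE => /andP[yG Py]; by exists (subg G y); rewrite ?inE subgK.
pose Zs := [set x : subg_of G | val x \in 'Z(G)%g].
have ZsE x : (x \in Zs) = (val x \in 'Z(G)%g) by rewrite in_set.
have cardZs : #|Zs| = m.
  rewrite (card_subg (mem 'Z(G)%g)) -cardZ; apply: eq_card => y; rewrite inE.
  by apply/andP/idP => [[] //|yZ]; rewrite (subsetP (center_sub G)).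
(* There are p + 1 cliques of m(p - 1) vertices, one for each centralizer of a noncentral
   element. *)
rewrite /kappa (@num_spanning_trees_clique_join _ _ Zs p (m * p.-1).-1 c).
- rewrite cardZs prednK ?muln_gt0; last by apply/andP; split; lia.
  have -> : m + p.+1 * (m * p.-1) = n by rewrite nE; nia.
  have -> : m + m * p.-1 = m * p by nia.
  (* The count is now n^(m-1) (mp)^E m^p with n = m p^2, so p has exponent 2(m-1) + E and m has
     exponent (m-1) + E + p. *)
  set E := p.+1 * _; have EE : E + (m + p + 1) = n.
    have e1 : (m * p.-1).-1.+1 = m * p.-1 by rewrite prednK // muln_gt0; lia.
    have : E + p.+1 = p.+1 * (m * p.-1) by rewrite -e1 mulnS addnC.
    by rewrite nE; move: E p_gt1 => E; clear; case: p => // t; nia.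
  have -> : n + m - p - 3 = m.-1 + m.-1 + E by lia.
  have -> : n - 2 = m.-1 + E + p by lia.
  by rewrite {1}nE !expnMn !expnD; nia.
- by rewrite cardZs; lia.
- move=> x y; rewrite /= /commuting_rel; congr (_ && _); rewrite !ZsE -val_eqE /=.
  have [xZ|xZ] /= := boolP (val x \in 'Z(G)%g).
    have /centerP[_ xC] := xZ; apply/eqP; exact: (xC _ (subgP y)).
  have [yZ|yZ] /= := boolP (val y \in 'Z(G)%g).
    have /centerP[_ yC] := yZ; apply/eqP/esym; exact: (yC _ (subgP x)).
  rewrite (commute_cent1_eq p_pr idx) ?noncentral // cE //.
  by rewrite inordK ?nth_index ?ltK ?cent1K.
move=> i; rewrite prednK; last by rewrite muln_gt0; apply/andP; split; lia.
(* As [K] has exactly p + 1 members, every colour [i] is the centralizer of some noncentral [x]. *)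
have /imsetP[x xGZ iE] : nth set0 (enum K) i \in K.
  by rewrite -mem_enum mem_nth // -cardE cardK.
rewrite -cardZ -(card_cent1_fiber p_pr idx xGZ) -iE.
transitivity #|[set x : subg_of G |
    (val x \notin 'Z(G)%g) && ('C_G[val x]%g == nth set0 (enum K) i)]|.
  apply: eq_card => y; rewrite 2!in_set ZsE.
  by have [//|yZ] := boolP (val y \in 'Z(G)%g); rewrite /= cE.
rewrite (card_subg (fun y => (y \notin 'Z(G)%g) && ('C_G[y]%g == nth set0 (enum K) i))).
by apply: eq_card => y; rewrite 2!in_set in_setD andbA [(_ \in G) && _]andbC.
Qed.
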